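(* Let $G$ be a 2-connected graph, $H$ a graph that is not a circuit, and $f:G\rightarrow H$ a circuit surjection. Then there exist graphs $G_1,G_2$ and maps $k:E(G)\to E(G_1)$, $h:E(G_1)\to E(G_2)$, $q:E(G_2)\to E(H)$ with $f=q\circ h\circ k$, such that: (i) $k$ is a bijection which preserves circuits in both directions, i.e. for $C\subseteq E(G)$, $C$ is a circuit of $G$ if and only if $k(C)$ is a circuit of $G_1$; (ii) $h$ is an onto edge map obtained by replacing suspended chains of $G_1$ by single edges (i.e. $G_2$ arises from $G_1$ by replacing each member of a family of pairwise edge-disjoint suspended chains by a single edge joining its two endpoints, $h$ sends every edge of such a chain to the corresponding new edge and fixes all other edges), and $h$ preserves circuits in both directions (the images under $h$ of circuits of $G_1$ are exactly the circuits of $G_2$); (iii) $q$ is a circuit injection.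
   Context: Graphs are undirected, without loops or multiple edges, and not necessarily finite. A circuit surjection $f:G\rightarrow H$ is a map from $E(G)$ onto $E(H)$ such that for every circuit $C$ of $G$, $f(C)$ is a circuit of $H$; $H$ is required to have no isolated vertices. A circuit injection is a circuit surjection that is one-to-one. ''$H$ is not a circuit'' means $H$ is not itself a single cycle. A suspended chain of a graph $G_1$ is a subgraph $P$ with a finite vertex set $V(P)$, $|V(P)|\geq 3$, having two distinct vertices $v_1,v_2$ (its endpoints) with $\deg_P v_1=\deg_P v_2=1$ and $\deg_P v=\deg_{G_1} v=2$ for all other $v\in V(P)$ (so $P$ is a path whose interior vertices have degree 2 in $G_1$). *)

(* Defs.v *)
From Stdlib Require Import List Relations.
Import ListNotations.
Set Implicit Arguments.

Record Graph := mkGraph {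
  V : Type;
  E : Type;
  src : E -> V;
  dst : E -> V;
  no_loop : forall e, src e <> dst e;
  no_multi : forall e e', (src e' = src e /\ dst e' = dst e) \/
                          (src e' = dst e /\ dst e' = src e) -> e = e'
}.
Arguments src {_} _.
Arguments dst {_} _.

Definition joins {G : Graph} (e : E G) (u v : V G) : Prop :=
  (src e = u /\ dst e = v) \/ (src e = v /\ dst e = u).

Definition incident {G : Graph} (e : E G) (v : V G) : Prop :=
  src e = v \/ dst e = v.

Definition adj {G : Graph} (u v : V G) : Prop := exists e : E G, joins e u v.

Fixpoint walk {G : Graph} (vs : list (V G)) (es : list (E G)) : Prop :=
  match vs, es with
  | u :: ((v :: _) as vs'), e :: es' => joins e u v /\ walk vs' es'
  | [_], [] => True
  | _, _ => False
  end.

Definition circuit {G : Graph} (C : E G -> Prop) : Prop :=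
  exists (u : V G) (vs : list (V G)) (es : list (E G)) (e : E G),
    NoDup (u :: vs) /\ 2 <= length vs /\ walk (u :: vs) es /\
    joins e (last vs u) u /\
    (forall x, C x <-> In x (e :: es)).

Definition image {A B : Type} (f : A -> B) (C : A -> Prop) : B -> Prop :=
  fun y => exists x, C x /\ f x = y.

Definition no_isolated (H : Graph) : Prop :=
  forall v : V H, exists e : E H, incident e v.

Definition circuit_surjection {G H : Graph} (f : E G -> E H) : Prop :=
  no_isolated H /\
  (forall y : E H, exists x, f x = y) /\
  (forall C, circuit C -> circuit (image f C)).

Definition circuit_injection {G H : Graph} (f : E G -> E H) : Prop :=
  circuit_surjection f /\ (forall x y, f x = f y -> x = y).

Definition connected (G : Graph) : Prop :=
  forall u v : V G, clos_refl_trans _ (@adj G) u v.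

Definition two_connected (G : Graph) : Prop :=
  (exists x y z : V G, x <> y /\ y <> z /\ x <> z) /\
  connected G /\
  (forall w u v : V G, u <> w -> v <> w ->
     clos_refl_trans _ (fun a b => a <> w /\ b <> w /\ adj a b) u v).

(* P (an edge set) is a suspended chain of G with endpoints a, b:
   a path a = v0, ..., vn = b (n >= 2 edges, distinct vertices) whose interior
   vertices have degree 2 in G, i.e. all their G-edges lie on the path. *)
Definition suspended_chain {G : Graph} (P : E G -> Prop) (a b : V G) : Prop :=
  exists (vs : list (V G)) (es : list (E G)),
    NoDup vs /\ 3 <= length vs /\ walk vs es /\
    hd a vs = a /\ last vs a = b /\
    (forall x, P x <-> In x es) /\
    (forall v, In v vs -> v <> a -> v <> b ->
       forall e : E G, incident e v -> In e es).

Definition vset {G : Graph} (P : E G -> Prop) (v : V G) : Prop :=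
  exists e, P e /\ incident e v.

(* G2 arises from G1 by replacing each chain of a family of pairwise
   edge-disjoint suspended chains by a single edge joining its endpoints;
   h sends each chain edge to the new edge and fixes all other edges.
   phi identifies the vertices of G2 with the vertices of G1 that are not
   interior vertices of any chain of the family. *)
Definition chain_replacement {G1 G2 : Graph} (h : E G1 -> E G2) : Prop :=
  exists (I : Type) (P : I -> E G1 -> Prop) (a b : I -> V G1)
         (phi : V G2 -> V G1),
    (forall i, suspended_chain (P i) (a i) (b i)) /\
    (forall i j x, i <> j -> P i x -> P j x -> False) /\
    (forall w w', phi w = phi w' -> w = w') /\
    (forall v : V G1,
       (exists w, phi w = v) <->
       ~ (exists i, vset (P i) v /\ v <> a i /\ v <> b i)) /\
    (forall e, (forall i, ~ P i e) ->
       joins e (phi (src (h e))) (phi (dst (h e)))) /\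
    (forall i e, P i e ->
       ((phi (src (h e)) = a i /\ phi (dst (h e)) = b i) \/
        (phi (src (h e)) = b i /\ phi (dst (h e)) = a i))) /\
    (forall e e', h e = h e' <-> (e = e' \/ exists i, P i e /\ P i e')) /\
    (forall y, exists x, h x = y).

(* Main.v *)
From Stdlib Require Import List Relations Arith Bool Lia Permutation.
From Stdlib Require Import Classical ClassicalEpsilon FunctionalExtensionality PropExtensionality.
Require Import Defs.
Import ListNotations.
Set Implicit Arguments.

(* If two distinct circuits K1, K2 of G that share an edge have the same image D,
   then f maps every edge into D, so H is a circuit: otherwise take a circuit
   through some g with f g outside D whose part Q outside K1 and K2 is minimal.
   It splits each Ki into two halves that Q completes to circuits. In the cycle
   space of H the images of the halves of K1 and of K2 agree up to a swap, and
   circuits with equal images, other than D, that differ only inside K1 and K2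
   must coincide, so K1 = K2. It follows that two edges with the same image lie
   on the same circuits: a circuit through x but not y would give a theta graph
   whose three circuits all have f x = f y in their image, and in H this
   forces two of the images to be equal.

   Hence no Whitney twist has to be carried out explicitly. Let S consist of all
   edges except one representative of each fibre of f. Then G2 := G / S has edge
   set E(H), and G1 is G2 with each edge y subdivided into a path whose edges are
   the members of the fibre of y. Thus E(G1) = E(G), k and q are identities and
   h = f. Since G and G1 both contract onto G2 along S, and all their circuits are
   unions of fibres, both have as circuits the preimages of the circuits of G2. *)

(** * Circuits and edge cuts *)

Lemma last_cons {A : Type} (l : list A) (a d : A) : last (a :: l) d = last l a.
Proof.
  revert a d; induction l as [|b l IH]; intros a d; [reflexivity|].
  change (last (b :: l) d = last (b :: l) a); now rewrite !IH.
Qed.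

Lemma joins_sym {G : Graph} (e : E G) u v : joins e u v -> joins e v u.
Proof. unfold joins; tauto. Qed.

Lemma joins_unique {G : Graph} (e e' : E G) u v : joins e u v -> joins e' u v -> e = e'.
Proof.
  intros [[H1 H2]|[H1 H2]] [[H3 H4]|[H3 H4]]; apply no_multi; subst;
    (left; split; congruence) || (right; split; congruence).
Qed.

Lemma joins_neq {G : Graph} (e : E G) u v : joins e u v -> u <> v.
Proof. intros H ->. apply (@no_loop G e). destruct H as [[? ?]|[? ?]]; congruence. Qed.

Lemma joins_incident {G : Graph} (e : E G) u v w : joins e u v -> (incident e w <-> w = u \/ w = v).
Proof. intros [[<- <-]|[<- <-]]; unfold incident; intuition. Qed.

Lemma walk_incident {G : Graph} (vs : list (V G)) es e v :
  walk vs es -> In e es -> incident e v -> In v vs.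
Proof.
  revert es; induction vs as [|a vs IH]; intros es Hw He Hv; [destruct es; contradiction|].
  destruct vs as [|b vs], es as [|x es]; simpl in Hw; try contradiction.
  destruct Hw as [Hj Hw], He as [->|He].
  - rewrite (joins_incident v Hj) in Hv. simpl; intuition.
  - right; eapply IH; eauto.
Qed.

Lemma walk_NoDup {G : Graph} (vs : list (V G)) es : walk vs es -> NoDup vs -> NoDup es.
Proof.
  revert es; induction vs as [|a vs IH]; intros es Hw Hn; [destruct es; [constructor|contradiction]|].
  destruct vs as [|b vs], es as [|x es]; simpl in Hw; try contradiction; [constructor|].
  destruct Hw as [Hj Hw]; apply NoDup_cons_iff in Hn; destruct Hn as [Ha Hn]; constructor; [|now apply IH].
  intro Hx; apply Ha; eapply walk_incident; eauto.
  apply (joins_incident a Hj); auto.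
Qed.

Lemma walk_suffix {G : Graph} (vs1 : list (V G)) u vs2 es :
  walk (vs1 ++ u :: vs2) es -> exists es', walk (u :: vs2) es' /\ incl es' es.
Proof.
  revert es; induction vs1 as [|a vs1 IH]; intros es Hw; [exists es; split; [exact Hw|apply incl_refl]|].
  destruct es as [|x es]; [destruct vs1; contradiction|].
  destruct (IH es) as [es' [H1 H2]].
  { destruct vs1; simpl in *; tauto. }
  exists es'; split; [exact H1|now apply incl_tl].
Qed.

Lemma walk_split {G : Graph} (es1 : list (E G)) x es2 vs u :
  walk (u :: vs) (es1 ++ x :: es2) ->
  exists vs1 v vs2, vs = vs1 ++ v :: vs2 /\ walk (u :: vs1) es1 /\
    joins x (last vs1 u) v /\ walk (v :: vs2) es2.
Proof.
  revert u vs; induction es1 as [|a es1 IH]; intros u vs Hw; (destruct vs as [|v vs]; [destruct Hw|]);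
    destruct Hw as [Hj Hw].
  - exists [], v, vs; simpl; auto.
  - destruct (IH _ _ Hw) as (vs1 & w & vs2 & -> & H1 & H2 & H3).
    exists (v :: vs1), w, vs2; rewrite last_cons; simpl; auto.
Qed.

(** With [chi] the indicator of a vertex set, this is membership in the edge cut around that set.
    Parity against such cuts stands in for cycle space arguments. *)
Definition crosses {G : Graph} (chi : V G -> bool) (e : E G) : bool :=
  xorb (chi (src e)) (chi (dst e)).

Lemma crosses_joins {G : Graph} (chi : V G -> bool) (e : E G) u v :
  joins e u v -> crosses chi e = xorb (chi u) (chi v).
Proof. intros [[<- <-]|[<- <-]]; [reflexivity|apply xorb_comm]. Qed.

Lemma walk_parity {G : Graph} (chi : V G -> bool) vs u es :
  walk (u :: vs) es ->
  Nat.odd (length (filter (crosses chi) es)) = xorb (chi u) (chi (last vs u)).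
Proof.
  revert u es; induction vs as [|v vs IH]; intros u es Hw.
  - destruct es; [simpl; now destruct (chi u)|contradiction].
  - destruct es as [|e es]; [contradiction|]; destruct Hw as [Hj Hw].
    rewrite last_cons; specialize (IH _ _ Hw); simpl; rewrite (crosses_joins chi Hj).
    destruct (chi u), (chi v), (chi (last vs v)); simpl in *; rewrite ?Nat.odd_succ, <- ?Nat.negb_odd, IH; reflexivity.
Qed.

Lemma circuit_edges {G : Graph} (C : E G -> Prop) : circuit C ->
  exists l : list (E G), NoDup l /\ 3 <= length l /\ (forall x, C x <-> In x l) /\
    forall chi, Nat.odd (length (filter (crosses chi) l)) = false.
Proof.
  intros (u & vs & es & e & Hn & Hlen & Hw & Hj & HC).
  assert (Hes : length es = length vs).
  { clear -Hw; revert u es Hw; induction vs as [|v vs IH]; intros u [|x es] Hw; try easy.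
    simpl; f_equal; eapply IH; apply Hw. }
  exists (e :: es); repeat split; try apply HC.
  - constructor; [|eapply walk_NoDup; eauto].
    destruct vs as [|v vs]; [simpl in Hlen; lia|]; destruct es as [|x es]; [contradiction|].
    destruct Hw as [Hx Hw]; apply NoDup_cons_iff in Hn; destruct Hn as [Hu Hn].
    intros [->|He].
    (* If the closing edge were the first edge of the walk, the walk would end at its second vertex
       [v]; with at least two vertices after [u], this repeats [v]. *)
    + rewrite last_cons in Hj; apply joins_sym in Hj.
      assert (Hv : last vs v = v).
      { destruct Hx as [[? ?]|[? ?]], Hj as [[? ?]|[? ?]]; try congruence;
          exfalso; apply Hu; left; congruence. }
      destruct vs as [|w vs]; [simpl in Hlen; lia|].
      apply NoDup_cons_iff in Hn; apply (proj1 Hn).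
      rewrite <- Hv at 1; rewrite last_cons.
      clear; revert w; induction vs as [|z vs IH]; intros w; [now left|].
      rewrite last_cons; right; apply IH.
    + apply Hu; eapply walk_incident; eauto.
      apply (joins_incident u Hj); auto.
  - simpl; lia.
  - intro chi; pose proof (walk_parity chi _ _ _ Hw) as Hp; simpl.
    rewrite (crosses_joins chi Hj).
    destruct (chi u), (chi (last vs u)); simpl in *; rewrite ?Nat.odd_succ, <- ?Nat.negb_odd, Hp; reflexivity.
Qed.

Lemma circuit_ext {G : Graph} (C C' : E G -> Prop) :
  (forall x, C x <-> C' x) -> circuit C -> circuit C'.
Proof.
  intros H (u & vs & es & e & H1 & H2 & H3 & H4 & H5).
  exists u, vs, es, e; repeat split; auto; intro Hx; [apply H5, H, Hx|apply H, H5, Hx].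
Qed.

(** A circuit has at least three edges. This is what later rules out loops and multiple edges in the
    contracted graph. *)
Lemma circuit_not_pair {G : Graph} (C : E G -> Prop) y z :
  circuit C -> ~ (forall x, C x -> x = y \/ x = z).
Proof.
  intros HC H; destruct (circuit_edges HC) as (l & Hn & Hl & Hin & _).
  assert (Hi : incl l [y; z]).
  { intros x Hx; apply Hin, H in Hx; simpl; intuition. }
  apply (NoDup_incl_length Hn) in Hi; simpl in Hi; lia.
Qed.

Lemma circuit_nonempty {G : Graph} (C : E G -> Prop) : circuit C -> exists x, C x.
Proof. intros (u & vs & es & e & _ & _ & _ & _ & H); exists e; apply H; now left. Qed.

Lemma circuit_cut {G : Graph} (C : E G -> Prop) chi e :
  circuit C -> C e -> crosses chi e = true ->
  exists e', e' <> e /\ C e' /\ crosses chi e' = true.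
Proof.
  intros HC He Hc; destruct (circuit_edges HC) as (l & Hn & _ & Hin & Hp).
  apply NNPP; intro Hno; specialize (Hp chi).
  assert (HP : Permutation (filter (crosses chi) l) [e]).
  { apply NoDup_Permutation; [now apply NoDup_filter|repeat constructor; simpl; tauto|].
    intro x; rewrite filter_In, <- Hin; simpl; split.
    - intros [Hx Hcx]; left; apply NNPP; intro; apply Hno; exists x; auto.
    - intros [<-|[]]; auto. }
  apply Permutation_length in HP; rewrite HP in Hp; discriminate.
Qed.

Definition dec (P : Prop) : bool := if excluded_middle_informative P then true else false.

Lemma dec_true (P : Prop) : dec P = true <-> P.
Proof. unfold dec; destruct (excluded_middle_informative P); split; auto; discriminate. Qed.

Lemma dec_false (P : Prop) : dec P = false <-> ~ P.
Proof. unfold dec; destruct (excluded_middle_informative P); split; auto; tauto || discriminate. Qed.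

Definition reach {G : Graph} (A : E G -> Prop) : V G -> V G -> Prop :=
  clos_refl_trans _ (fun u v => exists e, A e /\ joins e u v).

Lemma reach_sym {G : Graph} (A : E G -> Prop) u v : reach A u v -> reach A v u.
Proof.
  induction 1 as [u v (e & He & Hj)| |]; [|apply rt_refl|eapply rt_trans; eauto].
  apply rt_step; exists e; split; [auto|now apply joins_sym].
Qed.

Lemma reach_mono {G : Graph} (A B : E G -> Prop) u v :
  (forall e, A e -> B e) -> reach A u v -> reach B u v.
Proof.
  intro HAB; induction 1 as [u v (e & He & Hj)| |]; [|apply rt_refl|eapply rt_trans; eauto].
  apply rt_step; exists e; auto.
Qed.

Lemma reach_path {G : Graph} (A : E G -> Prop) u v : reach A u v ->
  exists vs es, NoDup (u :: vs) /\ walk (u :: vs) es /\ last vs u = v /\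
    (forall x, In x es -> A x).
Proof.
  intro H; apply clos_rt_rt1n in H.
  induction H as [u|u w v (e & He & Hj) _ (vs & es & Hn & Hw & Hl & HA)].
  - exists [], []; repeat split; [repeat constructor; auto|simpl; tauto].
  - destruct (classic (In u (w :: vs))) as [Hi|Hi].
    (* The path returns to [u]: cut off everything before that visit. *)
    + destruct (in_split _ _ Hi) as (l1 & l2 & Heq); rewrite Heq in Hw, Hn.
      destruct (walk_suffix _ _ _ _ Hw) as (es' & Hw' & Hincl).
      exists l2, es'; repeat split; auto.
      * clear -Hn; induction l1; [exact Hn|]; apply IHl1; simpl in Hn.
        now apply NoDup_cons_iff in Hn.
      * rewrite <- Hl, <- (last_cons vs w u), Heq.
        clear; induction l1 as [|a l1 IH]; simpl app; [now rewrite last_cons|].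
        rewrite IH at 1. destruct l1; reflexivity.
    + exists (w :: vs), (e :: es); repeat split; auto.
      * now constructor.
      * now rewrite last_cons.
      * intros x [<-|Hx]; auto.
Qed.

Lemma reach_circuit {G : Graph} (A : E G -> Prop) e :
  ~ A e -> reach A (src e) (dst e) ->
  exists C, circuit C /\ C e /\ (forall x, C x -> x = e \/ A x).
Proof.
  intros He H; destruct (reach_path H) as (vs & es & Hn & Hw & Hl & HA).
  exists (fun x => In x (e :: es)); repeat split; [|now left|intros x [<-|Hx]; auto].
  exists (src e), vs, es, e; repeat split; auto.
  (* A path without edges would make [e] a loop; a path with one edge would be parallel to [e],
     hence equal to [e], which is not in [A]. *)
  - destruct vs as [|v [|w vs]]; [|destruct es as [|x [|]]; simpl in Hw; try tauto|simpl; lia].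
    + simpl in Hl; now apply no_loop in Hl.
    + exfalso; apply He; replace e with x; [apply HA; now left|].
      destruct Hw as [Hj _]; simpl in Hl; subst v; apply (joins_unique Hj); now left.
  - rewrite Hl; now right.
Qed.

Lemma reach_crosses {G : Graph} (A : E G -> Prop) u e :
  A e -> crosses (fun v => dec (reach A u v)) e = false.
Proof.
  intro He; unfold crosses.
  assert (H : reach A (src e) (dst e)) by (apply rt_step; exists e; split; [auto|now left]).
  replace (reach A u (dst e)) with (reach A u (src e)); [apply xorb_nilpotent|].
  apply propositional_extensionality; split; intro; eapply rt_trans; eauto; now apply reach_sym.
Qed.

(** With [reach_crosses]: if [A] does not connect the ends of [e], the component of [src e] gives a
    cut that contains [e] and misses [A]. *)
Lemma separated_crosses {G : Graph} (A : E G -> Prop) e :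
  ~ reach A (src e) (dst e) -> crosses (fun v => dec (reach A (src e) v)) e = true.
Proof.
  intro H; unfold crosses; rewrite (proj2 (dec_false _) H), (proj2 (dec_true _)); [reflexivity|].
  apply rt_refl.
Qed.

(** Otherwise the component of [src e] in [C] without [e] would give a cut that [C] meets in [e]
    alone. *)
Lemma circuit_reach {G : Graph} (C : E G -> Prop) e :
  circuit C -> C e -> reach (fun x => C x /\ x <> e) (src e) (dst e).
Proof.
  intros HC He; apply NNPP; intro H.
  destruct (circuit_cut _ _ HC He (separated_crosses _ H)) as (x & Hx & HCx & Hc).
  rewrite reach_crosses in Hc; [discriminate|auto].
Qed.

Definition symdiff {A : Type} (C C' : A -> Prop) (x : A) : Prop :=
  (C x /\ ~ C' x) \/ (C' x /\ ~ C x).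

(** If the rest of the symmetric difference did not connect the ends of [e], the cut around a
    component would meet [C] and [C'] in sets that differ exactly by [e], yet both have even
    size. *)
Lemma circuit_symdiff {G : Graph} (C C' : E G -> Prop) e :
  circuit C -> circuit C' -> symdiff C C' e ->
  exists Z, circuit Z /\ Z e /\ (forall x, Z x -> symdiff C C' x).
Proof.
  intros HC HC' He.
  destruct (classic (reach (fun x => symdiff C C' x /\ x <> e) (src e) (dst e))) as [H|H].
  - apply reach_circuit in H; [|tauto].
    destruct H as (Z & HZ & HZe & Hsub); exists Z; repeat split; auto.
    intros x Hx; destruct (Hsub x Hx) as [->|[? _]]; auto.
  - exfalso; pose proof (separated_crosses _ H) as Hce.
    destruct (circuit_edges HC) as (l & Hn & _ & Hin & Hp).
    destruct (circuit_edges HC') as (l' & Hn' & _ & Hin' & Hp').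
    set (chi := fun v => dec (reach (fun x => symdiff C C' x /\ x <> e) (src e) v)) in *.
    assert (Heq : forall x, x <> e -> crosses chi x = true -> (C x <-> C' x)).
    { intros x Hx Hc; destruct (classic (symdiff C C' x)) as [Hs|Hs]; [|unfold symdiff in Hs; tauto].
      unfold chi in Hc; rewrite reach_crosses in Hc; [discriminate|auto]. }
    assert (HP : Permutation (filter (crosses chi) l) (e :: filter (crosses chi) l') \/
                 Permutation (filter (crosses chi) l') (e :: filter (crosses chi) l)).
    { destruct He as [[He1 He2]|[He1 He2]]; [left|right];
      (apply NoDup_Permutation; [now apply NoDup_filter| |]);
      try (constructor; [rewrite filter_In, <- ?Hin, <- ?Hin'; tauto|now apply NoDup_filter]);
      intro x; simpl; rewrite !filter_In, <- Hin, <- Hin';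
      (destruct (classic (x = e)) as [->|Hx]; [tauto|]);
      specialize (Heq x Hx); split; [intros [? ?]|intros [<-|[? ?]]|intros [? ?]|intros [<-|[? ?]]]; tauto. }
    specialize (Hp chi); specialize (Hp' chi).
    destruct HP as [HP|HP]; apply Permutation_length in HP; rewrite HP in *; simpl length in *;
      rewrite Nat.odd_succ, <- Nat.negb_odd in *; rewrite ?Hp, ?Hp' in *; discriminate.
Qed.

(** Deleting the closing edge [e] and another edge [m] leaves two arcs of [C'], so some cut meets
    [C'] exactly in [e] and [m]. Hence a circuit inside [C'] contains both or neither; being
    nonempty, it contains [e], and then every [m]. *)
Lemma circuit_minimal {G : Graph} (C C' : E G -> Prop) :
  circuit C -> circuit C' -> (forall x, C x -> C' x) -> forall x, C x <-> C' x.
Proof.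
  intros HC (u & vs & es & e & Hn & Hlen & Hw & Hj & HC') Hsub x; split; [auto|].
  assert (Hcut : forall m, In m es -> exists chi, crosses chi e = true /\ crosses chi m = true /\
            forall z, In z es -> crosses chi z = true -> z = m).
  { intros m Hm; destruct (in_split _ _ Hm) as (es1 & es2 & ->).
    destruct (walk_split _ _ _ _ _ Hw) as (vs1 & v & vs2 & -> & Hw1 & Hjm & Hw2).
    rewrite app_comm_cons in Hn.
    assert (Hdisj : forall w, In w (u :: vs1) -> In w (v :: vs2) -> False).
    { intros w H1 H2; destruct (in_split _ _ H1) as (a1 & a2 & Ha); rewrite Ha in Hn.
      rewrite <- app_assoc in Hn; apply NoDup_remove_2 in Hn; apply Hn.
      rewrite !in_app_iff; auto. }
    assert (Hlast : forall (l : list (V G)) a, In (last l a) (a :: l)).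
    { clear; induction l as [|b l IH]; intro a; [now left|rewrite last_cons; right; apply IH]. }
    assert (Hla : last (vs1 ++ v :: vs2) u = last vs2 v).
    { clear; revert u; induction vs1 as [|a vs1 IH]; intro u; simpl app; rewrite last_cons; auto. }
    rewrite Hla in Hj.
    (* The cut separates the arc [u :: vs1] before [m] from the arc [v :: vs2] after it. *)
    set (chi := fun w => dec (In w (u :: vs1))).
    assert (Ht : forall w, In w (u :: vs1) -> chi w = true) by (intro; apply dec_true).
    assert (Hf : forall w, In w (v :: vs2) -> chi w = false)
      by (intros w Hv; apply dec_false; intro; eauto).
    exists chi; repeat split.
    - rewrite (crosses_joins _ Hj), (Hf _ (Hlast _ _)), (Ht u); [reflexivity|now left].
    - rewrite (crosses_joins _ Hjm), (Ht _ (Hlast _ _)), (Hf v); [reflexivity|now left].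
    - intros z Hz Hc; unfold crosses in Hc.
      rewrite in_app_iff in Hz; destruct Hz as [Hz|[->|Hz]]; auto; exfalso.
      + rewrite !Ht in Hc; [discriminate| |]; eapply walk_incident; eauto; [right|left]; auto.
      + rewrite !Hf in Hc; [discriminate| |]; eapply walk_incident; eauto; [right|left]; auto. }
  assert (HCe : C e).
  { apply NNPP; intro Hne; destruct (circuit_nonempty HC) as [m Hm].
    assert (Hin : forall z, C z -> In z es).
    { intros z Hz; destruct (proj1 (HC' z) (Hsub z Hz)) as [->|]; [contradiction|auto]. }
    destruct (Hcut m (Hin m Hm)) as (chi & _ & H2 & H3).
    destruct (circuit_cut _ _ HC Hm H2) as (z & Hz & HCz & Hc); eauto. }
  intro Hx; apply HC' in Hx; destruct Hx as [<-|Hx]; [exact HCe|].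
  destruct (Hcut x Hx) as (chi & H1 & _ & H3).
  destruct (circuit_cut _ _ HC HCe H1) as (z & Hz & HCz & Hc).
  destruct (proj1 (HC' z) (Hsub z HCz)) as [->|Hin]; [contradiction|].
  now rewrite <- (H3 z Hin Hc).
Qed.

(** * Circuits through given edges *)

(** The list [l] only bounds the size of [B]; the induction is on its length, shortened by an
    element that a smaller competitor omits. *)
Lemma minimal_subset {A : Type} (P : (A -> Prop) -> Prop) (l : list A) (B : A -> Prop) :
  P B -> (forall x, B x -> In x l) ->
  exists B', P B' /\ (forall x, B' x -> B x) /\
    forall B'', P B'' -> (forall x, B'' x -> B' x) -> forall x, B' x -> B'' x.
Proof.
  remember (length l) as n eqn:Hn; revert l B Hn.
  induction n as [n IH] using lt_wf_ind; intros l B -> HB Hl.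
  destruct (classic (exists B'' a, P B'' /\ (forall x, B'' x -> B x) /\ B a /\ ~ B'' a))
    as [(B'' & a & HB'' & Hsub & Ha & Hna)|Hno].
  - destruct (in_split _ _ (Hl a Ha)) as (l1 & l2 & ->).
    edestruct (IH (length (l1 ++ l2))) as (B' & H1 & H2 & H3);
      [|reflexivity|exact HB''| |exists B'; repeat split; eauto].
    + rewrite !length_app; simpl; lia.
    + intros x Hx; pose proof (Hl x (Hsub x Hx)) as Hin.
      rewrite in_app_iff in *; simpl in Hin; destruct Hin as [|[->|]]; tauto.
  - exists B; repeat split; auto; intros B'' HB'' Hsub x Hx.
    apply NNPP; intro; apply Hno; exists B'', x; auto.
Qed.

(* Minimality of [C1 \ K] makes [K], [C1], [C2] the three circuits of a theta graph. *)
Lemma circuit_ear {G : Graph} (K C : E G -> Prop) g x0 :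
  circuit K -> ~ K g -> circuit C -> C g -> C x0 -> K x0 ->
  exists C1 C2, circuit C1 /\ circuit C2 /\ C1 g /\ C2 g /\
    (forall x, K x <-> symdiff C1 C2 x) /\ (forall x, C1 x -> ~ K x -> C x).
Proof.
  intros HK Hg HC HCg HCx HKx.
  destruct (circuit_edges HC) as (l & _ & _ & Hl & _).
  destruct (@minimal_subset _ (fun B => exists C', circuit C' /\ C' g /\ (exists x, C' x /\ K x) /\
      forall x, C' x -> K x \/ B x) l C) as (B & (C1 & HC1 & Hg1 & (x1 & Hx1 & HKx1) & Hsub1) & HBC & Hmin).
  { exists C; repeat split; eauto. }
  { apply Hl. }
  assert (HB1 : forall x, B x -> C1 x /\ ~ K x).
  { apply Hmin; [|intros x [H1 H2]; destruct (Hsub1 x H1); tauto].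
    exists C1; repeat split; eauto; intros x Hx; destruct (classic (K x)); auto. }
  (* The second circuit is found in the symmetric difference of [K] and [C1]. It meets [K], since
     otherwise it would lie inside [C1] and equal it; so it competes for minimality and contains all
     of [B]. *)
  destruct (@circuit_symdiff _ K C1 g) as (C2 & HC2 & Hg2 & Hsub2); auto; [right; auto|].
  assert (HC2K : exists x, C2 x /\ K x).
  { apply NNPP; intro Hno.
    assert (Heq : forall x, C2 x <-> C1 x).
    { apply circuit_minimal; auto; intros x Hx; destruct (Hsub2 x Hx) as [[? ?]|[? ?]]; auto.
      exfalso; eauto. }
    apply Heq in Hx1; eauto. }
  assert (HB2 : forall x, B x -> C2 x /\ ~ K x).
  { apply Hmin; [exists C2|].
    - repeat split; auto; intros x Hx; destruct (classic (K x)); auto.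
    - intros x [H1 H2]; destruct (Hsub2 x H1) as [[? ?]|[H3 ?]]; [contradiction|].
      destruct (Hsub1 x H3); tauto. }
  assert (Hdiff : forall x, symdiff C1 C2 x -> K x).
  { intros x [[H1 H2]|[H1 H2]].
    - destruct (Hsub1 x H1) as [|Hx]; auto; apply HB2 in Hx; tauto.
    - destruct (Hsub2 x H1); tauto. }
  exists C1, C2; do 4 (split; [assumption|]); split.
  - intro x; split; [|apply Hdiff].
    (* The difference of [C1] and [C2] lies in [K] and contains a circuit, which must then be all of
       [K]. *)
    destruct (@circuit_symdiff _ C1 C2 x1) as (Z & HZ & HZx & HZsub); auto.
    { left; split; auto; intro H; destruct (Hsub2 x1 H); tauto. }
    intro Hx; apply HZsub; apply (circuit_minimal HZ HK); auto.
  - intros x H1 H2; destruct (Hsub1 x H1); [contradiction|auto].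
Qed.

(** If [C] misses [z], an ear through [z] splits [C] into two halves, each completed by the ear to a
    circuit through [z]; [x] lies on one of them. *)
Lemma common_circuit_trans {G : Graph} (C C' : E G -> Prop) x y z :
  circuit C -> C x -> C y -> circuit C' -> C' y -> C' z ->
  exists Z, circuit Z /\ Z x /\ Z z.
Proof.
  intros HC Hx Hy HC' Hy' Hz.
  destruct (classic (C z)); [eauto|].
  destruct (@circuit_ear _ C C' z y) as (C1 & C2 & H1 & H2 & H3 & H4 & H5 & _); auto.
  destruct (proj1 (H5 x) Hx) as [[? _]|[? _]]; eauto.
Qed.

(** The far ends of [e] and [e'] are connected away from [w]. A circuit through [e] whose other
    edges avoid [w] or equal [e'] must use [e'], because it meets the star of [w] evenly. *)
Lemma adjacent_common_circuit {G : Graph} (e e' : E G) w :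
  two_connected G -> incident e w -> incident e' w -> e <> e' ->
  exists C, circuit C /\ C e /\ C e'.
Proof.
  intros (_ & _ & H2) Hw Hw' Hne.
  assert (Hjo : forall x : E G, incident x w -> exists u, joins x w u).
  { intros x [<-|<-]; eexists; [left|right]; split; reflexivity. }
  destruct (Hjo e Hw) as [u Hu], (Hjo e' Hw') as [v Hv].
  set (A := fun x => x = e' \/ ~ incident x w).
  assert (Huv : reach A w u).
  { eapply rt_trans; [apply rt_step; exists e'; split; [now left|exact Hv]|].
    assert (H : clos_refl_trans _ (fun a b => a <> w /\ b <> w /\ adj a b) v u).
    { apply H2; apply not_eq_sym; eauto using joins_neq. }
    clear Hu Hv; induction H as [a b (Ha & Hb & x & Hx)| |]; [|apply rt_refl|eapply rt_trans; eauto].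
    apply rt_step; exists x; split; [right|exact Hx].
    intro Hi; apply (joins_incident w Hx) in Hi; destruct Hi; congruence. }
  assert (HeA : ~ A e) by (intros [?|?]; auto).
  assert (Hends : reach A (src e) (dst e)).
  { destruct Hu as [[-> ->]|[-> ->]]; [|apply reach_sym]; exact Huv. }
  destruct (reach_circuit _ HeA Hends) as (C & HC & HCe & Hsub).
  exists C; repeat split; auto.
  assert (Hchi : forall x, crosses (fun a => dec (a = w)) x = true <-> incident x w).
  { intro x; unfold crosses, incident.
    destruct (classic (src x = w)) as [H|H], (classic (dst x = w)) as [H'|H'];
      rewrite ?(proj2 (dec_true _) H), ?(proj2 (dec_true _) H'), ?(proj2 (dec_false _) H),
        ?(proj2 (dec_false _) H'); simpl; try tauto; [|intuition discriminate].
    exfalso; apply (@no_loop G x); congruence. }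
  destruct (@circuit_cut _ C (fun a => dec (a = w)) e) as (x & Hx & HCx & Hc); auto.
  { now apply Hchi. }
  apply Hchi in Hc; destruct (Hsub x HCx) as [->|[->|]]; tauto.
Qed.

(** Sharing a circuit with [e] passes from an edge to an adjacent one, and connectivity reaches
    every edge. *)
Lemma common_circuit {G : Graph} (e e' : E G) :
  two_connected G -> e <> e' -> exists C, circuit C /\ C e /\ C e'.
Proof.
  intros H2 Hne.
  assert (H : forall v, reach (fun _ => True) (src e) v -> forall x, incident x v -> x <> e ->
     exists C, circuit C /\ C e /\ C x).
  { intros v Hv; apply clos_rt_rtn1 in Hv; induction Hv as [|v w (y & _ & Hy) _ IH]; intros x Hx Hxe.
    - apply (@adjacent_common_circuit _ e x (src e)); auto; now left.
    - assert (Hyw : incident y w) by (apply (joins_incident _ Hy); auto).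
      assert (Hyv : incident y v) by (apply (joins_incident _ Hy); auto).
      destruct (classic (y = e)) as [->|Hye].
      + eapply adjacent_common_circuit; eauto.
      + destruct (classic (x = y)) as [->|Hxy]; [eauto|].
        destruct (IH y Hyv Hye) as (C & HC & HCe & HCy).
        destruct (@adjacent_common_circuit _ y x w) as (C' & HC' & HCy' & HCx); auto.
        eapply common_circuit_trans with (C := C) (C' := C'); eauto. }
  apply (H (src e')); [|now left|auto].
  destruct H2 as (_ & Hc & _); specialize (Hc (src e) (src e')).
  clear H; induction Hc as [a b [y Hy]| |]; [|apply rt_refl|eapply rt_trans; eauto].
  apply rt_step; exists y; auto.
Qed.

(** * Circuits with equal images *)

Definition preserves_circuits {G H : Graph} (f : E G -> E H) : Prop :=
  forall C, circuit C -> circuit (image f C).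

Lemma image_intro {A B : Type} (f : A -> B) (C : A -> Prop) x : C x -> image f C (f x).
Proof. exists x; auto. Qed.

Lemma not_symdiff {A : Type} (C C' : A -> Prop) x : ~ symdiff C C' x -> (C x <-> C' x).
Proof. unfold symdiff; intro H; split; intro; apply NNPP; tauto. Qed.

(** Each edge of the theta graph lies on two of its circuits, so no edge of [H] lies in exactly one
    image. A circuit in the symmetric difference of the images of [C0] and [C1] is therefore
    contained in, and equal to, the image of [C2]; so no edge lies in all three. *)
Lemma theta_image {G H : Graph} (f : E G -> E H) (C0 C1 C2 : E G -> Prop) :
  preserves_circuits f -> circuit C0 -> circuit C1 -> circuit C2 ->
  (forall x, C0 x <-> symdiff C1 C2 x) ->
  ~ (forall y, image f C0 y <-> image f C1 y) ->
  forall y, image f C0 y <-> symdiff (image f C1) (image f C2) y.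
Proof.
  intros Hf H0 H1 H2 Hsd Hne.
  assert (Htwo : forall y, (image f C0 y -> image f C1 y \/ image f C2 y) /\
      (image f C1 y -> image f C0 y \/ image f C2 y) /\
      (image f C2 y -> image f C0 y \/ image f C1 y)).
  { intro y; repeat split; intros (x & Hx & <-); specialize (Hsd x); unfold symdiff in Hsd;
      destruct (classic (C1 x)), (classic (C2 x)); try tauto; 
      solve [left; apply image_intro; tauto | right; apply image_intro; tauto]. }
  assert (Hz : exists z, image f C0 z /\ ~ image f C1 z).
  { apply NNPP; intro Hno; apply Hne, circuit_minimal; auto.
    intros y Hy; apply NNPP; eauto. }
  destruct Hz as (z & Hz0 & Hz1).
  destruct (@circuit_symdiff _ (image f C0) (image f C1) z) as (Z & HZ & _ & Hsub); auto;
    [now left|].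
  assert (Heq : forall y, Z y <-> image f C2 y).
  { apply circuit_minimal; auto; intros y Hy; specialize (Htwo y).
    destruct (Hsub y Hy); tauto. }
  assert (Hno : forall y, image f C2 y -> symdiff (image f C0) (image f C1) y).
  { intros y Hy; apply Hsub, Heq, Hy. }
  intro y; specialize (Htwo y); specialize (Hno y); clear -Htwo Hno; unfold symdiff in *.
  destruct (classic (image f C0 y)), (classic (image f C1 y)), (classic (image f C2 y)); tauto.
Qed.

Lemma equal_images_exhaust {G H : Graph} (f : E G -> E H) (K1 K2 : E G -> Prop) x0 g :
  two_connected G -> preserves_circuits f ->
  circuit K1 -> circuit K2 -> K1 x0 -> K2 x0 -> ~ (forall x, K1 x <-> K2 x) ->
  (forall y, image f K1 y <-> image f K2 y) -> image f K1 (f g).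
Proof.
  intros HG Hf HK1 HK2 Hx1 Hx2 Hne HD; apply NNPP; intro Hg.
  assert (HgT : forall x, K1 x \/ K2 x -> f x <> f g).
  { intros x [Hx|Hx] Heq; apply Hg; [|apply HD]; rewrite <- Heq; now apply image_intro. }
  (* With T the union of [K1] and [K2], a set [B] qualifies if some circuit through [g] meets T and
     stays in [B] outside T. A minimal such [B] serves both thetas. *)
  set (P := fun B : E G -> Prop => exists C, circuit C /\ C g /\ (exists x, C x /\ (K1 x \/ K2 x)) /\
      forall x, C x -> (K1 x \/ K2 x) \/ B x).
  assert (HP : exists l B, P B /\ forall x, B x -> In x l).
  { destruct (@common_circuit _ g x0 HG) as (C & HC & HCg & HCx).
    { intros ->; apply (HgT x0); auto. }
    destruct (circuit_edges HC) as (l & _ & _ & Hl & _).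
    exists l, C; split; [|apply Hl]; exists C; repeat split; eauto. }
  destruct HP as (l & B0 & HB0 & Hl).
  destruct (minimal_subset _ _ _ HB0 Hl) as (B & (C & HC & HCg & (x & HCx & HTx) & Hsub) & _ & Hmin).
  clear B0 HB0 Hl l.
  (* Stated for [K] and [K'] so that it applies to [K1], [K2] in either order. *)
  assert (Hear : forall K K', circuit K -> circuit K' -> K x0 -> K' x0 ->
      (forall x, (K1 x \/ K2 x) <-> (K x \/ K' x)) -> (forall y, image f K y <-> image f K1 y) ->
      exists C1 C2, circuit C1 /\ circuit C2 /\ C1 g /\ C2 g /\
        (forall x, K x <-> symdiff C1 C2 x) /\
        (forall y, image f K1 y <-> symdiff (image f C1) (image f C2) y) /\
        (forall x, C1 x /\ ~ K x <-> B x) /\ (forall x, B x -> ~ (K x \/ K' x))).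
  { intros K K' HK HK' HKx HKx' HT HKD.
    (* The ear needs a circuit that meets [K] itself. If [C] meets only [K'], an ear over [K'] gives
       two circuits, one of which contains [x0], an edge of [K]. *)
    assert (HC' : exists C' x, circuit C' /\ C' g /\ C' x /\ K x /\
              forall x, C' x -> (K x \/ K' x) \/ B x).
    { destruct (classic (exists z, C z /\ K z)) as [(z & Hz & HKz)|Hno].
      - exists C, z; repeat split; auto; intros w Hw; rewrite <- HT; auto.
      - assert (HK'g : ~ K' g) by (intro; apply (HgT g); auto; apply HT; auto).
        assert (HK'x' : K' x) by (apply HT in HTx; destruct HTx; [exfalso; eauto|auto]).
        destruct (circuit_ear g x HK' HK'g HC HCg HCx HK'x') as (C1 & C2 & H1 & H2 & Hg1 & Hg2 & Hsd & Hout).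
        assert (Hout1 : forall w, C1 w -> (K w \/ K' w) \/ B w).
        { intros w Hw; destruct (classic (K' w)); [auto|].
          apply HT || rewrite <- HT; apply Hsub; auto. }
        assert (Hout2 : forall w, C2 w -> (K w \/ K' w) \/ B w).
        { intros w Hw; destruct (classic (K' w)); [auto|].
          apply Hout1; specialize (Hsd w); unfold symdiff in Hsd; apply NNPP; tauto. }
        destruct (proj1 (Hsd x0) HKx') as [[? _]|[? _]]; [exists C1, x0|exists C2, x0]; auto. }
    destruct HC' as (C' & z & HC' & HC'g & HC'z & HKz & HC'sub).
    assert (HKg : ~ K g) by (intro; apply (HgT g); auto; apply HT; auto).
    destruct (circuit_ear g z HK HKg HC' HC'g HC'z HKz) as (C1 & C2 & H1 & H2 & Hg1 & Hg2 & Hsd & Hout).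
    assert (Him : forall y, image f K y <-> symdiff (image f C1) (image f C2) y).
    { apply theta_image; auto; intro Heq; apply Hg, HKD, Heq; now apply image_intro. }
    (* Such an edge in T would lie on both [C1] and [C2], putting its image in both of theirs, while
       its image lies in the common image of [K1] and [K2], their symmetric difference. *)
    assert (HC1out : forall w, C1 w -> ~ K w -> ~ (K w \/ K' w)).
    { intros w Hw1 Hw HTw.
      assert (Hw2 : C2 w) by (specialize (Hsd w); unfold symdiff in Hsd; apply NNPP; tauto).
      assert (HDw : image f K1 (f w)).
      { apply HT in HTw; destruct HTw; [|apply HD]; now apply image_intro. }
      apply HKD, Him in HDw.
      pose proof (image_intro f _ _ Hw1); pose proof (image_intro f _ _ Hw2).
      unfold symdiff in HDw; tauto. }
    assert (HCB : forall w, C1 w /\ ~ K w -> B w).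
    { intros w [Hw1 Hw2]; destruct (HC'sub w (Hout w Hw1 Hw2)) as [Hw|]; auto.
      exfalso; eapply HC1out; eauto. }
    assert (HBC : forall w, B w -> C1 w /\ ~ K w).
    { apply Hmin; auto; exists C1; repeat split; auto.
      - apply NNPP; intro Hno.
        assert (Heq : forall w, C1 w <-> C2 w).
        { apply circuit_minimal; auto; intros w Hw; apply NNPP; intro Hw2.
          apply Hno; exists w; split; auto; apply HT; left; apply Hsd; left; auto. }
        apply Hsd in HKx; unfold symdiff in HKx; specialize (Heq x0); tauto.
      - intros w Hw; rewrite HT; destruct (classic (K w)); auto. }
    exists C1, C2; split; [auto|]; split; [auto|]; split; [auto|]; split; [auto|].
    split; [auto|]; split; [intro y; rewrite <- HKD; auto|]; split.
    - intro w; split; [apply HCB|apply HBC].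
    - intros w Hw; apply HBC in Hw; apply HC1out; tauto. }
  destruct (Hear K1 K2) as (C11 & C21 & H11 & H21 & Hg11 & Hg21 & Hs1 & Hi1 & HB1 & HBT);
    auto; try tauto.
  destruct (Hear K2 K1) as (C12 & C22 & H12 & H22 & Hg12 & Hg22 & Hs2 & Hi2 & HB2 & _);
    auto; try (intro; rewrite HD || idtac; tauto).
  clear Hear Hmin Hsub P.
  (* Otherwise a circuit in the difference of [Z1] and [Z2] has its image in, hence equal to, that
     of [K1]. This image then lies in, hence equals, the image of [Z1], which contains [f g]. *)
  assert (Hsame : forall Z1 Z2, circuit Z1 -> circuit Z2 -> Z1 g ->
      (forall x, symdiff Z1 Z2 x -> K1 x \/ K2 x) ->
      (forall y, image f Z1 y <-> image f Z2 y) -> forall x, Z1 x <-> Z2 x).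
  { intros Z1 Z2 HZ1 HZ2 Hg1 Hsd Him; apply NNPP; intro Hno.
    assert (Hx : exists x, Z1 x /\ ~ Z2 x).
    { apply NNPP; intro; apply Hno, circuit_minimal; auto; intros w Hw; apply NNPP; eauto. }
    destruct Hx as (w & Hw1 & Hw2).
    destruct (@circuit_symdiff _ Z1 Z2 w) as (Z & HZ & _ & HZsub); auto; [now left|].
    assert (HZD : forall y, image f Z y <-> image f K1 y).
    { apply circuit_minimal; auto; intros y (z & Hz & <-).
      destruct (Hsd z (HZsub z Hz)); [|apply HD]; now apply image_intro. }
    apply Hg.
    assert (Hall : forall y, image f K1 y <-> image f Z1 y).
    { apply circuit_minimal; auto; intros y Hy; apply HZD in Hy; destruct Hy as (z & Hz & <-).
      destruct (HZsub z Hz) as [[? _]|[? _]]; [|apply Him]; now apply image_intro. }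
    apply Hall; now apply image_intro. }
  (* Outside T all four circuits coincide with [B]. *)
  assert (HT : forall Z1 Z2, (Z1 = C11 \/ Z1 = C21) -> (Z2 = C12 \/ Z2 = C22) ->
      forall x, symdiff Z1 Z2 x -> K1 x \/ K2 x).
  { intros Z1 Z2 HZ1 HZ2 w Hw.
    apply NNPP; intro Hout.
    assert (E1 : C11 w <-> C21 w) by (apply not_symdiff; rewrite <- Hs1; tauto).
    assert (E2 : C12 w <-> C22 w) by (apply not_symdiff; rewrite <- Hs2; tauto).
    assert (E3 : C11 w <-> C12 w).
    { specialize (HB1 w); specialize (HB2 w); clear -HB1 HB2 Hout; tauto. }
    clear -HZ1 HZ2 E1 E2 E3 Hw; unfold symdiff in Hw.
    destruct HZ1 as [-> | ->], HZ2 as [-> | ->]; tauto. }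
  (* The images of the completed halves of [K1] and [K2] match either in this order or crosswise; in
     both cases [Hsame] identifies the halves, so [K1] and [K2] coincide. *)
  destruct (classic (forall y, image f C11 y <-> image f C12 y)) as [Heq|Hneq].
  - assert (Heq' : forall y, image f C21 y <-> image f C22 y).
    { intro y; specialize (Heq y); specialize (Hi1 y); specialize (Hi2 y); clear -Heq Hi1 Hi2; unfold symdiff in *.
      split; intro; apply NNPP; tauto. }
    pose proof (Hsame C11 C12 H11 H12 Hg11 (HT _ _ (or_introl eq_refl) (or_introl eq_refl)) Heq) as E1.
    pose proof (Hsame C21 C22 H21 H22 Hg21 (HT _ _ (or_intror eq_refl) (or_intror eq_refl)) Heq') as E2.
    apply Hne; intro w; rewrite Hs1, Hs2; unfold symdiff; rewrite E1, E2; tauto.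
  - assert (Hy : exists y, image f C11 y /\ ~ image f C12 y).
    { apply NNPP; intro; apply Hneq, circuit_minimal; auto; intros w Hw; apply NNPP; eauto. }
    destruct Hy as (y0 & Hy1 & Hy2).
    assert (Him : forall Z1 Z2, (forall x, symdiff Z1 Z2 x -> K1 x \/ K2 x) ->
       forall y, image f Z1 y -> ~ image f Z2 y -> image f K1 y).
    { intros Z1 Z2 Hsd y (w & Hw & <-) Hw2.
      destruct (Hsd w); [left; split; auto; intro; apply Hw2; now apply image_intro| |apply HD];
        now apply image_intro. }
    assert (HsdD : forall y, symdiff (image f C11) (image f C12) y -> image f K1 y).
    { intros y [[Ha Hb]|[Ha Hb]].
      - apply (Him C11 C12); [apply HT; now left| |]; assumption.
      - apply (Him C12 C11); [|assumption|assumption].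
        intros w Hw; apply (HT C11 C12); [now left|now left|unfold symdiff in *; tauto]. }
    (* The images of [C11] and [C12] differ only inside the image of [K1], so by minimality of
       circuits they differ by all of it; this forces the crosswise match. *)
    destruct (@circuit_symdiff _ (image f C11) (image f C12) y0) as (Z & HZ & _ & HZsub); auto; [now left|].
    assert (HZD : forall y, Z y <-> image f K1 y) by (apply circuit_minimal; auto).
    assert (Hall : forall y, image f K1 y <-> symdiff (image f C11) (image f C12) y).
    { intro y; split; [intro Hy; apply HZsub, HZD, Hy|apply HsdD]. }
    assert (Heq : forall y, image f C11 y <-> image f C22 y).
    { intro y; specialize (Hall y); specialize (Hi2 y); clear -Hall Hi2; unfold symdiff in *.
      split; intro; apply NNPP; tauto. }
    assert (Heq' : forall y, image f C21 y <-> image f C12 y).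
    { intro y; specialize (Hall y); specialize (Hi1 y); clear -Hall Hi1; unfold symdiff in *.
      split; intro; apply NNPP; tauto. }
    pose proof (Hsame C11 C22 H11 H22 Hg11 (HT _ _ (or_introl eq_refl) (or_intror eq_refl)) Heq) as E1.
    pose proof (Hsame C21 C12 H21 H12 Hg21 (HT _ _ (or_intror eq_refl) (or_introl eq_refl)) Heq') as E2.
    apply Hne; intro w; rewrite Hs1, Hs2; unfold symdiff; rewrite E1, E2; tauto.
Qed.

Definition fibre_closed {A B : Type} (f : A -> B) (C : A -> Prop) : Prop :=
  forall x x', C x -> f x = f x' -> C x'.

(** This is where it matters that [H] is not a circuit. *)
Lemma circuits_fibre_closed {G H : Graph} (f : E G -> E H) :
  two_connected G -> ~ circuit (fun _ : E H => True) -> circuit_surjection f ->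
  forall C, circuit C -> fibre_closed f C.
Proof.
  intros HG HH (_ & Hsurj & Hf) C HC x y Hx Hxy; apply NNPP; intro Hy.
  assert (Hne : x <> y) by (intros ->; auto).
  destruct (common_circuit HG Hne) as (C' & HC' & Hx' & Hy').
  destruct (circuit_ear y x HC Hy HC' Hy' Hx' Hx)
    as (C1 & C2 & H1 & H2 & Hy1 & Hy2 & Hsd & _).
  (* [Z1] is the theta circuit with both [x] and [y]. If its image is that of [C], this image
     exhausts [H]; otherwise the three images sum to zero modulo 2, although [f x] lies in all of
     them. *)
  assert (Hkey : forall Z1 Z2, circuit Z1 -> circuit Z2 -> Z1 x -> Z1 y -> Z2 y ->
            (forall z, C z <-> symdiff Z1 Z2 z) -> False).
  { intros Z1 Z2 HZ1 HZ2 Hx1 HyZ1 HyZ2 HsdZ; apply HH.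
    destruct (classic (forall z, image f C z <-> image f Z1 z)) as [Heq|Hneq].
    - apply circuit_ext with (image f C); [|auto].
      intro z; split; [auto|intros _]; destruct (Hsurj z) as [g <-].
      apply (@equal_images_exhaust _ _ f C Z1 x g); auto.
      intro HCZ; apply Hy, HCZ, HyZ1.
    - exfalso.
      pose proof (theta_image Hf HC HZ1 HZ2 HsdZ Hneq (f x)) as Hth.
      pose proof (image_intro f _ _ Hx); pose proof (image_intro f _ _ Hx1).
      assert (image f Z2 (f x)) by (rewrite Hxy; now apply image_intro).
      unfold symdiff in Hth; tauto. }
  destruct (proj1 (Hsd x) Hx) as [[Hx1 _]|[Hx2 _]].
  - apply (Hkey C1 C2); auto.
  - apply (Hkey C2 C1); auto; intro z; rewrite Hsd; unfold symdiff; tauto.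
Qed.

(** * Contracting edges *)

(* [p] is defined on all edges, but only its values outside [S] are constrained:
   there it identifies the edges that survive the contraction with those of [G']. *)
Definition contraction {G G' : Graph} (S : E G -> Prop) (p : E G -> E G') (pi : V G -> V G') : Prop :=
  (forall e, S e -> pi (src e) = pi (dst e)) /\
  (forall e, ~ S e -> joins (p e) (pi (src e)) (pi (dst e))) /\
  (forall u v, pi u = pi v -> reach S u v) /\
  (forall y, exists r, ~ S r /\ p r = y) /\
  (forall e e', ~ S e -> ~ S e' -> p e = p e' -> e = e').

Section Contraction.

Context {G G' : Graph} (S : E G -> Prop) (p : E G -> E G') (pi : V G -> V G').
Context (Hcon : contraction S p pi).
Context (Hclosed : forall C, circuit C -> fibre_closed p C).

(** Each edge of the path is replaced by its lift outside [S]; consecutive lifts are linked inside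
    [S]. *)
Lemma lift_reach (D : E G' -> Prop) a b : reach D a b ->
  forall u v, pi u = a -> pi v = b -> reach (fun x => S x \/ (~ S x /\ D (p x))) u v.
Proof.
  destruct Hcon as (HS & HnS & Hconn & Hrep & Hinj).
  assert (HSr : forall u v, pi u = pi v -> reach (fun x => S x \/ (~ S x /\ D (p x))) u v).
  { intros u v Huv; apply (@reach_mono _ S); auto. }
  intro H; apply clos_rt_rt1n in H; induction H as [a|a c b (e & He & Hj) _ IH]; intros u v Hu Hv.
  - apply HSr; congruence.
  - destruct (Hrep e) as (r & Hr & <-).
    assert (Hstep : forall s t, joins r s t -> reach (fun x => S x \/ (~ S x /\ D (p x))) s t).
    { intros s t Hst; apply rt_step; exists r; auto. }
    specialize (HnS r Hr).
    assert (Hends : (pi (src r) = a /\ pi (dst r) = c) \/ (pi (dst r) = a /\ pi (src r) = c)).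
    { destruct Hj as [[? ?]|[? ?]], HnS as [[? ?]|[? ?]]; [left|right|right|left]; split; congruence. }
    destruct Hends as [[H1 H2]|[H1 H2]].
    + eapply rt_trans; [apply HSr; transitivity a; [exact Hu|symmetry; exact H1]|].
      eapply rt_trans; [apply Hstep; left; split; reflexivity|apply IH; auto].
    + eapply rt_trans; [apply HSr; transitivity a; [exact Hu|symmetry; exact H1]|].
      eapply rt_trans; [apply Hstep; right; split; reflexivity|apply IH; auto].
Qed.

(** The lifted path avoids [r], which closes it. An edge of the resulting circuit may lie in [S],
    but the surviving edge of its fibre is on the circuit too, and that one maps into [D]. *)
Lemma lift_circuit (D : E G' -> Prop) : circuit D ->
  exists C, circuit C /\ (forall x, C x -> D (p x)).
Proof.
  intro HD; destruct (circuit_nonempty HD) as [y Hy].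
  pose proof Hcon as (HS & HnS & Hconn & Hrep & Hinj).
  destruct (Hrep y) as (r & Hr & <-).
  assert (Hreach : reach (fun z => D z /\ z <> p r) (pi (src r)) (pi (dst r))).
  { pose proof (circuit_reach _ HD Hy) as H; specialize (HnS r Hr).
    destruct HnS as [[<- <-]|[<- <-]]; [exact H|now apply reach_sym]. }
  pose proof (@lift_reach _ _ _ Hreach _ _ eq_refl eq_refl) as Hl.
  apply reach_circuit in Hl; [|tauto].
  destruct Hl as (C & HC & HCr & Hsub).
  exists C; split; auto; intros x Hx.
  destruct (Hrep (p x)) as (s & Hs & Hps).
  destruct (Hsub s (@Hclosed _ HC x s Hx (eq_sym Hps))) as [->|[|[_ [Hd _]]]]; [|contradiction|]; congruence.
Qed.

Lemma push_reach (A : E G -> Prop) u v : reach A u v ->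
  reach (fun y => exists x, A x /\ ~ S x /\ p x = y) (pi u) (pi v).
Proof.
  destruct Hcon as (HS & HnS & _).
  induction 1 as [u v (e & He & Hj)| |]; [|apply rt_refl|eapply rt_trans; eauto].
  destruct (classic (S e)) as [Hs|Hs].
  - replace (pi v) with (pi u); [apply rt_refl|].
    specialize (HS e Hs); destruct Hj as [[<- <-]|[<- <-]]; auto.
  - apply rt_step; exists (p e); split; [eauto|].
    specialize (HnS e Hs); destruct Hj as [[<- <-]|[<- <-]]; [auto|now apply joins_sym].
Qed.

(** Removing a surviving edge [r] from [C] leaves a path whose projection avoids [p r], by
    injectivity outside [S]; adding [p r] closes it. *)
Lemma push_circuit (C : E G -> Prop) : circuit C ->
  exists D, circuit D /\ (forall y, D y -> image p C y).
Proof.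
  intro HC; destruct (circuit_nonempty HC) as [x Hx].
  pose proof Hcon as (HS & HnS & Hconn & Hrep & Hinj).
  destruct (Hrep (p x)) as (r & Hr & Hpr).
  assert (HCr : C r) by (apply (@Hclosed _ HC x); auto).
  pose proof (push_reach (circuit_reach _ HC HCr)) as H.
  assert (Hends : reach (fun y => exists z, (C z /\ z <> r) /\ ~ S z /\ p z = y)
            (src (p r)) (dst (p r))).
  { destruct (HnS r Hr) as [[-> ->]|[-> ->]]; [exact H|now apply reach_sym]. }
  apply reach_circuit in Hends.
  - destruct Hends as (D & HD & HDr & Hsub); exists D; split; auto; intros y Hy.
    destruct (Hsub y Hy) as [->|(z & [Hz _] & _ & <-)]; now apply image_intro.
  - intros (z & [_ Hz] & Hsz & Hpz); apply Hz, Hinj; auto.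
Qed.

(** Lifting [D] and pushing back down gives a circuit inside [D], hence [D] itself. So the lift
    meets every fibre over [D], and then contains it. *)
Lemma contraction_circuit_preimage (D : E G' -> Prop) : circuit D -> circuit (fun x => D (p x)).
Proof.
  intro HD; destruct (lift_circuit HD) as (C & HC & Hsub).
  destruct (push_circuit HC) as (D' & HD' & Hsub').
  assert (Heq : forall y, D' y <-> D y).
  { apply circuit_minimal; auto; intros y Hy; destruct (Hsub' y Hy) as (x & Hx & <-); auto. }
  apply circuit_ext with C; auto; intro x; split; [auto|].
  intro Hx; apply Heq in Hx; destruct (Hsub' _ Hx) as (z & Hz & Hp); now apply (@Hclosed _ HC z).
Qed.

Lemma contraction_circuit_image (C : E G -> Prop) : circuit C -> circuit (image p C).
Proof.
  intro HC; destruct (push_circuit HC) as (D & HD & Hsub).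
  apply circuit_ext with D; auto; intro y; split; [auto|].
  assert (Heq : forall x, D (p x) <-> C x).
  { apply circuit_minimal; auto using contraction_circuit_preimage.
    intros x Hx; destruct (Hsub _ Hx) as (z & Hz & Hp); now apply (@Hclosed _ HC z). }
  intros (x & Hx & <-); now apply Heq.
Qed.

End Contraction.

(** * The graphs G1 and G2 *)

Section ChainDecomposition.

Context {G H : Graph} (f : E G -> E H).
Context (Hf : circuit_surjection f).
Context (Hclosed : forall C : E G -> Prop, circuit C -> fibre_closed f C).
Context (r : E H -> E G) (t : E H -> list (E G)).
Context (Hnodup : forall y, NoDup (r y :: t y)).
Context (Hfibre : forall y x, In x (r y :: t y) <-> f x = y).

Definition redundant (x : E G) : Prop := x <> r (f x).

Lemma f_r y : f (r y) = y.
Proof. apply Hfibre; now left. Qed.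

Lemma redundant_r y : ~ redundant (r y).
Proof. unfold redundant; rewrite f_r; auto. Qed.

Lemma not_redundant x : ~ redundant x -> x = r (f x).
Proof. apply NNPP. Qed.

Lemma in_tail y x : In x (t y) -> redundant x /\ f x = y.
Proof.
  intro Hx; assert (Hy : f x = y) by (apply Hfibre; now right).
  split; auto; intros Heq; rewrite Hy in Heq; subst x.
  specialize (Hnodup y); apply NoDup_cons_iff in Hnodup; tauto.
Qed.

Lemma successor_redundant y l1 a b l2 : r y :: t y = l1 ++ a :: b :: l2 -> redundant b.
Proof.
  intro Hl; apply (in_tail y); destruct l1; injection Hl; intros -> _; [now left|].
  apply in_or_app; right; right; now left.
Qed.

(** The case [y' = y] excludes loops after contraction, the other case multiple edges: a circuit
    through [r y] would have its image within [y] and [y']. *)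
Lemma representatives_reach y y' :
  reach (fun x => redundant x \/ (x = r y' /\ y' <> y)) (src (r y)) (dst (r y)) -> False.
Proof.
  intro Hr; apply reach_circuit in Hr.
  - destruct Hr as (C & HC & _ & Hsub); destruct Hf as (_ & _ & Hp).
    apply (@circuit_not_pair _ (image f C) y y' (Hp C HC)); intros z (x & Hx & <-).
    assert (HCr : C (r (f x))) by (apply (@Hclosed _ HC x); auto; now rewrite f_r).
    destruct (Hsub _ HCr) as [Heq|[Hred|[Heq _]]].
    + left; rewrite <- (f_r (f x)), Heq; apply f_r.
    + now apply redundant_r in Hred.
    + right; rewrite <- (f_r (f x)), Heq; apply f_r.
  - intros [Hred|[Heq Hne]]; [now apply redundant_r in Hred|].
    apply Hne; rewrite <- (f_r y), Heq; now rewrite f_r.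
Qed.

(** A component is encoded as its vertex predicate, so that extensionality turns reachability into
    equality. *)
Definition component : Type := {c : V G -> Prop | exists v, c = reach redundant v}.

Definition comp (v : V G) : component := exist _ (reach redundant v) (ex_intro _ v eq_refl).

Lemma comp_eq u v : comp u = comp v <-> reach redundant u v.
Proof.
  split.
  - intro Heq; apply (f_equal (@proj1_sig _ _)) in Heq; simpl in Heq.
    rewrite Heq; apply rt_refl.
  - intro Huv; apply eq_sig_hprop; [intros; apply proof_irrelevance|simpl].
    apply functional_extensionality; intro w; apply propositional_extensionality.
    split; intro; eapply rt_trans; eauto; now apply reach_sym.
Qed.

Lemma comp_no_loop y : comp (src (r y)) <> comp (dst (r y)).
Proof.
  rewrite comp_eq; intro Hr; apply (@representatives_reach y y).
  eapply reach_mono; [|exact Hr]; auto.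
Qed.

Lemma comp_no_multi y y' :
  (comp (src (r y')) = comp (src (r y)) /\ comp (dst (r y')) = comp (dst (r y))) \/
  (comp (src (r y')) = comp (dst (r y)) /\ comp (dst (r y')) = comp (src (r y))) -> y = y'.
Proof.
  rewrite !comp_eq; intro Hr; apply NNPP; intro Hne; apply (@representatives_reach y y').
  assert (Hm : forall u v, reach redundant u v ->
            reach (fun x => redundant x \/ (x = r y' /\ y' <> y)) u v).
  { intros u v; apply reach_mono; auto. }
  assert (Hstep : reach (fun x => redundant x \/ (x = r y' /\ y' <> y)) (src (r y')) (dst (r y'))).
  { apply rt_step; exists (r y'); split; [right; auto|now left]. }
  destruct Hr as [[H1 H2]|[H1 H2]].
  - eapply rt_trans; [apply reach_sym, Hm, H1|eapply rt_trans; [exact Hstep|apply Hm, H2]].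
  - eapply rt_trans; [apply reach_sym, Hm, H2|eapply rt_trans; [apply reach_sym, Hstep|apply Hm, H1]].
Qed.

Definition contracted : Graph := mkGraph _ _ comp_no_loop comp_no_multi.

Lemma contracted_contraction : @contraction G contracted redundant f comp.
Proof.
  repeat split.
  - intros e He; apply comp_eq, rt_step; exists e; split; [auto|now left].
  - intros e He; apply not_redundant in He; left; simpl; now rewrite <- He.
  - intros u v; apply comp_eq.
  - intro y; exists (r y); auto using redundant_r, f_r.
  - intros e e' He He' Heq; rewrite (not_redundant He), (not_redundant He'); congruence.
Qed.

(* The graph [contracted] with each edge [y] subdivided into a path with edges
   [r y :: t y]; an interior vertex of that path is named after the edge of
   the path that leaves it. *)
Definition subdivision_vertex : Type := (component + {x | redundant x})%type.

(** Each path is directed from the component of [src (r y)] to that of [dst (r y)], with [r y] as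
    its first edge. *)
Definition start (x : E G) : subdivision_vertex :=
  match excluded_middle_informative (redundant x) with
  | left Hx => inr (exist _ x Hx)
  | right _ => inl (comp (src (r (f x))))
  end.

Lemma start_redundant x (Hx : redundant x) : start x = inr (exist _ x Hx).
Proof.
  unfold start; destruct (excluded_middle_informative (redundant x)) as [H'|H']; [|contradiction].
  now rewrite (proof_irrelevance _ H' Hx).
Qed.

Lemma start_r y : start (r y) = inl (comp (src (r y))).
Proof.
  unfold start; destruct (excluded_middle_informative (redundant (r y))) as [H'|H'].
  - exfalso; exact (redundant_r H').
  - now rewrite f_r.
Qed.

Lemma start_inr x z : start x = inr z <-> x = proj1_sig z.
Proof.
  destruct z as [z Hz]; simpl; split.
  - unfold start; destruct (excluded_middle_informative (redundant x)); congruence.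
  - intros ->; apply start_redundant.
Qed.

Lemma start_inl x c : start x = inl c -> x = r (f x) /\ c = comp (src (r (f x))).
Proof.
  unfold start; destruct (excluded_middle_informative (redundant x)) as [H'|H']; [discriminate|].
  intros [= <-]; split; auto; now apply not_redundant.
Qed.

Fixpoint after (x : E G) (l : list (E G)) : list (E G) :=
  match l with
  | [] => []
  | a :: l' => if excluded_middle_informative (a = x) then l' else after x l'
  end.

Lemma after_app x l1 l2 : NoDup (l1 ++ x :: l2) -> after x (l1 ++ x :: l2) = l2.
Proof.
  induction l1 as [|a l1 IH]; simpl; intro Hn; destruct (excluded_middle_informative _) as [He|He];
    auto; try contradiction; apply NoDup_cons_iff in Hn; [|tauto].
  subst; exfalso; apply Hn; apply in_elt.
Qed.

(** This serves to show that only one edge enters a given interior vertex. *)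
Lemma NoDup_predecessor {A : Type} (l l' m m' : list A) a b c :
  NoDup (l ++ a :: c :: l') -> l ++ a :: c :: l' = m ++ b :: c :: m' -> a = b.
Proof.
  revert m; induction l as [|d l IH]; intros m Hn Heq.
  - destruct m as [|e m]; [now injection Heq|].
    exfalso; injection Heq as -> Heq; apply NoDup_cons_iff in Hn; destruct Hn as [_ Hn].
    destruct m as [|e' m]; injection Heq as Hc Heq.
    + subst; apply NoDup_cons_iff in Hn; apply (proj1 Hn); now left.
    + subst; apply NoDup_cons_iff in Hn; apply (proj1 Hn).
      apply in_or_app; right; right; now left.
  - destruct m as [|e m]; injection Heq as -> Heq; apply NoDup_cons_iff in Hn; destruct Hn as [Hd Hn].
    + exfalso; destruct l as [|e' l]; injection Heq as Hc Heq; subst.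
      * apply NoDup_cons_iff in Hn; apply (proj1 Hn); now left.
      * apply NoDup_cons_iff in Hn; apply (proj1 Hn).
        apply in_or_app; right; right; now left.
    + eapply IH; eauto.
Qed.

Lemma fibre_split x : exists l1, r (f x) :: t (f x) = l1 ++ x :: after x (r (f x) :: t (f x)).
Proof.
  destruct (in_split x (r (f x) :: t (f x))) as (l1 & l2 & Heq); [now apply Hfibre|].
  exists l1; pose proof (Hnodup (f x)) as Hn; rewrite Heq in *; now rewrite after_app.
Qed.

Definition finish (x : E G) : subdivision_vertex :=
  match after x (r (f x) :: t (f x)) with
  | [] => inl (comp (dst (r (f x))))
  | x' :: _ => start x'
  end.

Lemma finish_split y l1 x l2 : r y :: t y = l1 ++ x :: l2 ->
  finish x = hd (inl (comp (dst (r y)))) (map start l2).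
Proof.
  intro Heq; assert (Hx : f x = y) by (apply Hfibre; rewrite Heq; apply in_elt).
  unfold finish; rewrite Hx, Heq, after_app; [destruct l2; reflexivity|].
  rewrite <- Heq; apply Hnodup.
Qed.

Lemma finish_cases x :
  (finish x = inl (comp (dst (r (f x))))) \/
  (exists z l1 l2, finish x = inr z /\ r (f x) :: t (f x) = l1 ++ x :: proj1_sig z :: l2).
Proof.
  destruct (fibre_split x) as (l1 & Heq); pose proof (finish_split _ _ _ Heq) as Hfin.
  destruct (after x (r (f x) :: t (f x))) as [|z l2]; [now left|right].
  pose proof (@successor_redundant _ _ _ _ _ Heq) as Hz.
  exists (exist _ z Hz), l1, l2; split; [|exact Heq].
  rewrite Hfin; apply start_redundant.
Qed.

Lemma finish_f x z : finish x = inr z -> f (proj1_sig z) = f x.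
Proof.
  intro Hx; destruct (finish_cases x) as [H'|(z' & l1 & l2 & H' & Heq)]; [congruence|].
  rewrite H' in Hx; injection Hx as ->.
  apply Hfibre; rewrite Heq; apply in_or_app; right; right; now left.
Qed.

Lemma finish_inj x x' z : finish x = inr z -> finish x' = inr z -> x = x'.
Proof.
  intros Hx Hx'; pose proof (finish_f _ Hx) as E1; pose proof (finish_f _ Hx') as E2.
  destruct (finish_cases x) as [H'|(z1 & l1 & l2 & H1 & Heq1)]; [congruence|].
  destruct (finish_cases x') as [H'|(z2 & m1 & m2 & H2 & Heq2)]; [congruence|].
  rewrite H1 in Hx; injection Hx as ->; rewrite H2 in Hx'; injection Hx' as ->.
  rewrite <- E1 in Heq1; rewrite <- E2, Heq1 in Heq2.
  assert (Hn : NoDup (l1 ++ x :: proj1_sig z :: l2)) by (rewrite <- Heq1; apply Hnodup).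
  exact (NoDup_predecessor _ _ _ _ _ _ _ Hn Heq2).
Qed.

Lemma start_finish x : start x <> finish x.
Proof.
  intro Heq; destruct (finish_cases x) as [H'|(z & l1 & l2 & H' & Hl)]; rewrite H' in Heq.
  - apply start_inl in Heq; destruct Heq as [_ Heq]; symmetry in Heq; now apply comp_no_loop in Heq.
  - apply start_inr in Heq; rewrite <- Heq in Hl.
    pose proof (Hnodup (f x)) as Hn; rewrite Hl in Hn; apply NoDup_remove_2 in Hn.
    apply Hn, in_elt.
Qed.

Lemma subdivision_no_multi x x' :
  (start x' = start x /\ finish x' = finish x) \/ (start x' = finish x /\ finish x' = start x) ->
  x = x'.
Proof.
  intros [[Hs Hf']|[H1 H2]].
  - destruct (start x) as [c|z] eqn:Hx.
    + apply start_inl in Hx; apply start_inl in Hs; destruct Hx as [Hx Hc], Hs as [Hx' Hc'].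
      destruct (finish_cases x) as [E1|(z & _ & _ & E1 & _)]; rewrite E1 in Hf'.
      * destruct (finish_cases x') as [E2|(z & _ & _ & E2 & _)]; rewrite E2 in Hf'; [|discriminate].
        injection Hf' as Hf'; rewrite Hx, Hx'; f_equal; apply comp_no_multi; left.
        split; [congruence|apply comp_eq; rewrite Hf'; apply rt_refl].
      * eapply finish_inj; eauto.
    + apply start_inr in Hx; apply start_inr in Hs; congruence.
  - exfalso; destruct (start x) as [c|z] eqn:Hx.
    + apply start_inl in Hx; destruct Hx as [Hx Hc].
      destruct (finish_cases x') as [E2|(z & _ & _ & E2 & _)]; rewrite E2 in H2; [|discriminate].
      injection H2 as H2.
      destruct (finish_cases x) as [E1|(z & l1 & l2 & E1 & Hl)]; rewrite E1 in H1.
      * apply start_inl in H1; destruct H1 as [_ H1].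
        assert (Heq : f x = f x').
        { apply comp_no_multi; right; split; [symmetry; exact H1|rewrite <- Hc; exact H2]. }
        rewrite Heq in H1; symmetry in H1; now apply comp_no_loop in H1.
      * apply start_inr in H1; apply finish_f in E1; subst x'; rewrite E1 in H2.
        symmetry in H2; rewrite Hc in H2; now apply comp_no_loop in H2.
    + apply start_inr in Hx; pose proof (finish_f _ H2) as Hff; rewrite <- Hx in Hff.
      destruct (finish_cases x') as [E2|(z2 & m1 & m2 & E2 & Hl2)]; [congruence|].
      rewrite H2 in E2; injection E2 as <-; rewrite <- Hx in Hl2.
      destruct (finish_cases x) as [E1|(z1 & l1 & l2 & E1 & Hl)]; rewrite E1 in H1.
      * apply start_inl in H1; destruct H1 as [_ H1]; rewrite Hff in H1.
        symmetry in H1; now apply comp_no_loop in H1.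
      (* Here [x] and [x'] would each be the successor of the other in one duplicate-free list. *)
      * apply start_inr in H1; rewrite <- H1 in Hl.
        pose proof (Hnodup (f x)) as Hn; rewrite Hl in Hn.
        rewrite Hff, Hl2 in Hl.
        assert (A1 : after x (m1 ++ x' :: x :: m2) = m2).
        { change (x' :: x :: m2) with ([x'] ++ x :: m2); rewrite app_assoc.
          apply after_app; rewrite <- app_assoc; simpl; rewrite Hl; exact Hn. }
        assert (A2 : after x (l1 ++ x :: x' :: l2) = x' :: l2) by (apply after_app; exact Hn).
        rewrite <- Hl, A1 in A2; rewrite <- Hl, A2 in Hn.
        apply NoDup_remove_2 in Hn; apply Hn, in_or_app; right; right; now left.
Qed.

Definition subdivided : Graph := mkGraph _ _ start_finish subdivision_no_multi.

(** Only the first edge of a path survives the contraction, so every interior vertex collapses to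
    the terminal end. *)
Definition subdivision_proj (v : subdivision_vertex) : component :=
  match v with
  | inl c => c
  | inr z => comp (dst (r (f (proj1_sig z))))
  end.

(** The star of an interior vertex consists of two consecutive edges of its path, so a circuit uses
    both or neither; this propagates along the path. *)
Lemma subdivided_circuit_closed (C : E subdivided -> Prop) : circuit C -> fibre_closed f C.
Proof.
  intros HC x x' Hx Hff.
  assert (Hadj : forall y l1 a b l2, r y :: t y = l1 ++ a :: b :: l2 -> (C a <-> C b)).
  { intros y l1 a b l2 Hl.
    pose proof (@successor_redundant _ _ _ _ _ Hl) as Hb.
    assert (Hfin : finish a = inr (exist _ b Hb)).
    { rewrite (finish_split _ _ _ Hl); apply start_redundant. }
    set (chi := fun v : subdivision_vertex => dec (v = inr (exist _ b Hb))).
    assert (Hcr : forall e : E subdivided, @crosses subdivided chi e = true <-> e = a \/ e = b).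
    { intro e; unfold crosses; simpl.
      assert (Hs : chi (start e) = true <-> e = b).
      { unfold chi; rewrite dec_true, start_inr; reflexivity. }
      assert (Ht : chi (finish e) = true <-> e = a).
      { unfold chi; rewrite dec_true; split; [intro He; eapply finish_inj; eauto|now intros ->]. }
      assert (Hab : a <> b).
      { intros ->; pose proof (Hnodup y) as Hn; rewrite Hl in Hn.
        apply NoDup_remove_2 in Hn; apply Hn, in_elt. }
      destruct (chi (start e)), (chi (finish e)); simpl; intuition (congruence || auto). }
    split; intro HCe.
    - destruct (@circuit_cut subdivided C chi a HC HCe) as (e & Hne & HCe' & Hce); [now apply Hcr; left|].
      apply Hcr in Hce; destruct Hce as [->| ->]; tauto.
    - destruct (@circuit_cut subdivided C chi b HC HCe) as (e & Hne & HCe' & Hce); [now apply Hcr; right|].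
      apply Hcr in Hce; destruct Hce as [->| ->]; tauto. }
  assert (Hall : forall y l1 l2, r y :: t y = l1 ++ l2 -> forall z, In z l2 ->
            (C z <-> C (hd z l2))).
  { intros y l1 l2; revert l1; induction l2 as [|a l2 IH]; intros l1 Hl z Hz; [destruct Hz|].
    destruct Hz as [->|Hz]; [reflexivity|].
    destruct l2 as [|b l2]; [destruct Hz|].
    simpl; rewrite (Hadj _ _ _ _ _ Hl); apply (IH (l1 ++ [a])); auto.
    rewrite <- app_assoc; simpl; assumption. }
  assert (Hrep : forall z, C z <-> C (r (f z))).
  { intro z; apply (Hall (f z) [] _ eq_refl z); now apply Hfibre. }
  apply Hrep; rewrite <- Hff; exact (proj1 (Hrep x) Hx).
Qed.

Lemma subdivided_contraction : @contraction subdivided contracted redundant f subdivision_proj.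
Proof.
  assert (Hfin : forall x, subdivision_proj (finish x) = comp (dst (r (f x)))).
  { intro x; destruct (finish_cases x) as [->|(z & _ & _ & Hz & _)]; [reflexivity|].
    rewrite Hz; simpl; now rewrite (finish_f _ Hz). }
  assert (Hconn : forall v, @reach subdivided redundant v (inl (subdivision_proj v))).
  { assert (Hl : forall y l1 x l2, r y :: t y = l1 ++ x :: l2 -> redundant x ->
              @reach subdivided redundant (start x) (inl (comp (dst (r y))))).
    (* From an interior vertex, all remaining edges of the path are redundant and lead to its
       terminal end. *)
    { intros y l1 x l2; revert l1 x; induction l2 as [|x' l2 IH]; intros l1 x Heq Hx;
        pose proof (finish_split _ _ _ Heq) as Hfx; simpl in Hfx.
      - apply rt_step; exists x; split; [auto|left; auto].
      - eapply rt_trans; [apply rt_step; exists x; split; [auto|left; split; [reflexivity|exact Hfx]]|].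
        apply (IH (l1 ++ [x])); [rewrite <- app_assoc; simpl; assumption|].
        exact (@successor_redundant _ _ _ _ _ Heq). }
    intros [c|[x Hx]]; [apply rt_refl|simpl].
    destruct (fibre_split x) as (l1 & Heq); specialize (Hl _ _ _ _ Heq Hx).
    rewrite (start_redundant Hx) in Hl; exact Hl. }
  repeat split.
  - intros e He; simpl; rewrite (start_redundant He), Hfin; reflexivity.
  - intros e He; simpl; rewrite Hfin.
    apply not_redundant in He; rewrite He at 2; rewrite start_r; left; simpl; auto.
  - intros u v Huv; eapply rt_trans; [apply Hconn|rewrite Huv; apply reach_sym, Hconn].
  - intro y; exists (r y); split; [apply redundant_r|apply f_r].
  - intros e e' He He' Heq; rewrite (not_redundant He), (not_redundant He'); congruence.
Qed.

(** The redundant edge [x] ensures that the path has at least two edges, hence three vertices. *)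
Lemma fibre_suspended_chain y x : redundant x -> f x = y ->
  @suspended_chain subdivided (fun x => f x = y) (inl (comp (src (r y)))) (inl (comp (dst (r y)))).
Proof.
  intros Hx Hy.
  assert (Hint : forall z, In z (t y) -> exists Hz : redundant z, start z = inr (exist _ z Hz)).
  { intros z Hz; destruct (in_tail _ _ Hz) as [Hr _]; exists Hr; apply start_redundant. }
  assert (Hxt : In x (t y)).
  { apply Hfibre in Hy; destruct Hy as [Heq|]; auto; subst x; now apply redundant_r in Hx. }
  exists (map start (r y :: t y) ++ [inl (comp (dst (r y)))]), (r y :: t y).
  repeat match goal with |- _ /\ _ => split end.
  - simpl; rewrite start_r; constructor.
    + rewrite in_app_iff, in_map_iff; intros [(z & Hz & Hin)|[Heq|[]]].
      * destruct (Hint z Hin) as [Hr Hs]; rewrite Hs in Hz; discriminate.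
      * apply (comp_no_loop y); congruence.
    + apply NoDup_app; [| |].
      * apply NoDup_map_NoDup_ForallPairs.
        -- intros a b Ha Hb Hab; destruct (Hint a Ha) as [Hra Hsa], (Hint b Hb) as [Hrb Hsb].
           rewrite Hsa, Hsb in Hab; congruence.
        -- specialize (Hnodup y); now apply NoDup_cons_iff in Hnodup.
      * repeat constructor; auto.
      * intros v Hv [Heq|[]]; apply in_map_iff in Hv; destruct Hv as (z & Hz & Hin).
        destruct (Hint z Hin) as [Hr Hs]; congruence.
  - rewrite length_app, length_map; destruct (t y); [destruct Hxt|simpl; lia].
  - assert (Hw : forall l2 l1 z, r y :: t y = l1 ++ z :: l2 ->
       @walk subdivided (map start (z :: l2) ++ [inl (comp (dst (r y)))]) (z :: l2)).
    { induction l2 as [|z' l2 IH]; intros l1 z Heq; pose proof (finish_split _ _ _ Heq) as Hfin.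
      - simpl; split; [left; split; [reflexivity|exact Hfin]|exact I].
      - split; [left; split; [reflexivity|exact Hfin]|].
        apply (IH (l1 ++ [z])); rewrite <- app_assoc; simpl; assumption. }
    apply (Hw (t y) []); reflexivity.
  - simpl; now rewrite start_r.
  - apply last_last.
  - intro z; symmetry; apply Hfibre.
  - intros v Hv Hva Hvb e He; apply Hfibre.
    rewrite in_app_iff in Hv; destruct Hv as [Hv|[Hv|[]]]; [|congruence].
    apply in_map_iff in Hv; destruct Hv as (z & Hz & [<-|Hin]).
    + rewrite start_r in Hz; congruence.
    + destruct (Hint z Hin) as [Hr Hs]; rewrite Hs in Hz; subst v.
      destruct (in_tail _ _ Hin) as [_ <-].
      destruct He as [He|He]; simpl in He.
      * apply start_inr in He; simpl in He; congruence.
      * apply finish_f in He; simpl in He; congruence.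
Qed.

Lemma subdivided_chain_replacement : @chain_replacement subdivided contracted f.
Proof.
  (* The family is indexed by the fibres with more than one edge; the other paths are single edges
     and stay as they are. *)
  exists {y | exists x, redundant x /\ f x = y}, (fun i x => f x = proj1_sig i),
    (fun i => inl (comp (src (r (proj1_sig i))))), (fun i => inl (comp (dst (r (proj1_sig i))))),
    (fun c => inl c).
  repeat match goal with |- _ /\ _ => split end.
  - intros [y (x & Hx & Hy)]; simpl; eapply fibre_suspended_chain; eauto.
  - intros i j x Hij Hi Hj; apply Hij; apply eq_sig_hprop; [intros; apply proof_irrelevance|congruence].
  - intros w w' [=]; auto.
  - intros [c|[x Hx]]; split.
    + intros _ (i & (e & He & Hinc) & Ha & Hb); destruct Hinc as [Hinc|Hinc]; simpl in *.
      * apply start_inl in Hinc; apply Ha; rewrite <- He; f_equal; tauto.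
      * destruct (finish_cases e) as [Hfe|(z & _ & _ & Hfe & _)]; rewrite Hfe in Hinc; [|discriminate].
        apply Hb; rewrite <- He; auto.
    + intros _; now exists c.
    + intros [w Hw]; discriminate.
    + intro Hno; exfalso; apply Hno.
      exists (exist _ (f x) (ex_intro _ x (conj Hx eq_refl))); simpl; repeat split; try discriminate.
      exists x; split; [reflexivity|left; apply start_redundant].
  - intros e He; left; simpl.
    assert (Hone : forall z, redundant z -> f z = f e -> False).
    { intros z Hz Hfz; apply (He (exist _ (f e) (ex_intro _ z (conj Hz Hfz)))); reflexivity. }
    assert (Hre : e = r (f e)) by (apply not_redundant; intro; eauto).
    split; [rewrite Hre at 1; apply start_r|].
    destruct (finish_cases e) as [|(z & _ & _ & Hfe & _)]; auto.
    exfalso; apply (Hone (proj1_sig z) (proj2_sig z)); now apply finish_f.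
  - intros i e He; left; simpl; now rewrite He.
  - intros e e'; split.
    + intro Heq; destruct (classic (e = e')) as [|Hne]; [now left|right].
      assert (Hred : redundant e \/ redundant e').
      { apply NNPP; intro Hno; apply Hne; rewrite (@not_redundant e), (@not_redundant e') by tauto.
        now rewrite Heq. }
      destruct Hred as [Hr|Hr].
      * exists (exist _ (f e) (ex_intro _ e (conj Hr eq_refl))); simpl; auto.
      * exists (exist _ (f e') (ex_intro _ e' (conj Hr eq_refl))); simpl; auto.
    + intros [->|(i & H1 & H2)]; [reflexivity|congruence].
  - apply Hf.
Qed.

End ChainDecomposition.

(** Fibres are finite because two edges of a fibre lie on a common circuit, which then contains the
    whole fibre. *)
Lemma fibre_enumeration {G H : Graph} (f : E G -> E H) :
  two_connected G -> (forall y, exists x, f x = y) ->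
  (forall C : E G -> Prop, circuit C -> fibre_closed f C) ->
  forall y, exists rt : E G * list (E G),
    NoDup (fst rt :: snd rt) /\ forall x, In x (fst rt :: snd rt) <-> f x = y.
Proof.
  intros HG Hsurj Hclosed y; destruct (Hsurj y) as [x <-].
  destruct (classic (exists x', x' <> x /\ f x' = f x)) as [(x' & Hne & Heq)|Hno].
  - destruct (common_circuit HG Hne) as (C & HC & _ & HCx).
    destruct (circuit_edges HC) as (l & Hn & _ & Hin & _).
    set (l' := filter (fun z => dec (f z = f x)) l).
    assert (Hl' : forall z, In z l' <-> f z = f x).
    { intro z; unfold l'; rewrite filter_In, dec_true, <- Hin; split; [tauto|].
      intro Hz; split; auto; apply (Hclosed C HC x); auto. }
    assert (Hn' : NoDup l') by now apply NoDup_filter.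
    destruct l' as [|a l']; [exfalso; apply (proj2 (Hl' x)); reflexivity|].
    exists (a, l'); split; assumption.
  - exists (x, []); split; [repeat constructor; auto|].
    intro z; simpl; split; [intros [->|[]]; reflexivity|].
    intro Hz; left; apply NNPP; intro; apply Hno; exists z; auto.
Qed.

Theorem theorem1p1 (G H : Graph) (f : E G -> E H) :
  two_connected G ->
  ~ circuit (fun _ : E H => True) ->
  circuit_surjection f ->
  exists (G1 G2 : Graph) (k : E G -> E G1) (h : E G1 -> E G2) (q : E G2 -> E H),
    (forall e, f e = q (h (k e))) /\
    (* (i) *)
    ((forall x y, k x = k y -> x = y) /\ (forall y, exists x, k x = y) /\
     (forall C : E G -> Prop, circuit C <-> circuit (image k C))) /\
    (* (ii) *)
    (chain_replacement h /\
     (forall C, circuit C -> circuit (image h C)) /\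
     (forall D, circuit D -> exists C, circuit C /\ (forall y, D y <-> image h C y))) /\
    (* (iii) *)
    circuit_injection q.
Proof.
  intros HG HH Hf.
  pose proof (circuits_fibre_closed HG HH Hf) as Hclosed.
  pose proof Hf as (Hiso & Hsurj & Hpres).
  set (rt := fun y => proj1_sig (constructive_indefinite_description _ (fibre_enumeration HG Hsurj Hclosed y))).
  assert (Hrt : forall y, NoDup (fst (rt y) :: snd (rt y)) /\
            forall x, In x (fst (rt y) :: snd (rt y)) <-> f x = y)
    by (intro y; exact (proj2_sig (constructive_indefinite_description _ (fibre_enumeration HG Hsurj Hclosed y)))).
  set (r := fun y => fst (rt y)); set (t := fun y => snd (rt y)).
  assert (Hnodup : forall y, NoDup (r y :: t y)) by (intro; apply Hrt).
  assert (Hfibre : forall y x, In x (r y :: t y) <-> f x = y) by (intro; apply Hrt).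
  set (G2 := contracted Hf Hclosed r t Hfibre).
  set (G1 := subdivided Hf Hclosed r t Hnodup Hfibre).
  pose proof (contracted_contraction Hf Hclosed r t Hfibre) as Hcon.
  pose proof (subdivided_contraction Hf Hclosed r t Hnodup Hfibre) as Hcon1.
  assert (Hclosed1 : forall C : E G1 -> Prop, circuit C -> fibre_closed f C)
    by exact (@subdivided_circuit_closed _ _ f Hf Hclosed r t Hnodup Hfibre).
  assert (Him : forall D : E H -> Prop, forall y, D y <-> image f (fun x => D (f x)) y).
  { intros D y; split; [|intros (x & Hx & <-); exact Hx].
    intro Hy; destruct (Hsurj y) as [x <-]; now apply image_intro. }
  assert (Hid : forall C : E G -> Prop, forall x, C x <-> image (fun x => x) C x).
  { intros C x; split; [intro Hx; now exists x|intros (z & Hz & <-); exact Hz]. }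
  exists G1, G2, (fun x => x), f, (fun y => y).
  split; [reflexivity|]; split; [|split].
  - split; [auto|]; split; [eauto|]; intro C; split; intro HC.
    + apply (@circuit_ext G1 C); [apply Hid|].
      (* A circuit of [G] passes to [G2] as its image and back up to [G1] as a preimage; being a
         union of fibres, it is unchanged as an edge set. *)
      pose proof (contraction_circuit_preimage Hcon1 Hclosed1 (contraction_circuit_image Hcon Hclosed HC)) as HC1.
      eapply circuit_ext; [|exact HC1]; intro x; simpl; split; [|apply image_intro].
      intros (z & Hz & Heq); now apply (Hclosed C HC z).
    + assert (HC1 : @circuit G1 C) by (eapply circuit_ext; [|exact HC]; intro; symmetry; apply Hid).
      pose proof (contraction_circuit_preimage Hcon Hclosed (contraction_circuit_image Hcon1 Hclosed1 HC1)) as HC2.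
      eapply circuit_ext; [|exact HC2]; intro x; simpl; split; [|apply image_intro].
      intros (z & Hz & Heq); now apply (Hclosed1 C HC1 z).
  - split; [apply subdivided_chain_replacement|]; split.
    + intros C HC; apply (contraction_circuit_image Hcon1 Hclosed1 HC).
    + intros D HD; exists (fun x => D (f x)); split; [|apply Him].
      apply (contraction_circuit_preimage Hcon1 Hclosed1 HD).
  - split; [|auto]; split; [auto|]; split; [eauto|].
    (* A circuit of [G2] is lifted to its preimage in [G], which [f] sends onto the same edge set in
       [H]. *)
    intros D HD; apply (@circuit_ext H (image f (fun x => D (f x)))).
    + intro y; rewrite <- Him; split; [intro Hy; now exists y|intros (z & Hz & <-); exact Hz].
    + apply Hpres, (contraction_circuit_preimage Hcon Hclosed HD).
Qed.
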